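(* Let $\kappa,m$ be positive integers, $\mathcal F$ a family of twin-free graphs, $\mathcal G=\mathrm{Forb}(\mathcal F)$, $\gamma:\mathcal G^0_\kappa\to\mathbb R$, and $B$ a graph on $[m]$ with $B()\subseteq\mathcal G$ and $\lambda(\mathcal G)=\lambda(B())$. Suppose that the problem is robustly $B$-stable and that $B$ is $\lambda$-minimal. Then the problem is perfectly $B$-stable.
   Context: All graphs finite simple; ''subgraph'' means induced subgraph; twin-free means no two distinct vertices have the same neighbourhood. $P(F,G)$ = number of $v(F)$-subsets of $V(G)$ inducing a copy of $F$. Admissible graphs ($\mathrm{Forb}(\mathcal F)$) contain no member of $\mathcal F$ as induced subgraph; $\mathcal G^0_\kappa$ = representatives of isomorphism classes of admissible order-$\kappa$ graphs. $\Lambda(G)=\sum_H\gamma(H)P(H,G)$, $\lambda(G)=\Lambda(G)/\binom{v(G)}\kappa$, $\lambda(n,\mathcal G)=\max\{\lambda(G):G\in\mathcal G,v(G)=n\}$, $\lambda(\mathcal G)=\lim_n\lambda(n,\mathcal G)$. Blow-up $B(V_1,\dots,V_m)$: vertex set $\bigcup V_i$ (disjoint, possibly empty), $u\in V_i,w\in V_j$ adjacent iff $ij\in E(B)$; $B()$ = all blow-ups of $B$; $\mathbb S_m$ = probability simplex; $\lambda(B(\mathbf a))=\lim_n\lambda(B(V_{1,n},\dots,V_{m,n}))$ with $|V_{i,n}|=a_in+O(1)$; $\lambda(B())=\max_{\mathbf x\in\mathbb S_m}\lambda(B(\mathbf x))$. $B$ is $\lambda$-minimal if $\lambda(B'())<\lambda(B())$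 for every graph $B'$ obtained from $B$ by deleting a vertex. $\delta_{\mathrm{edit}}(G,B())$ = minimal number of adjacency changes turning $G$ (order $n$) into a blow-up of $B$, divided by $\binom n2$. Robustly $B$-stable: there is $C>0$ with $\delta_{\mathrm{edit}}(G,B())\le C\max(1/n,\lambda(n,\mathcal G)-\lambda(G))$ for all $G\in\mathcal G$ of order $n\ge C$. Perfectly $B$-stable: same with $C(\lambda(n,\mathcal G)-\lambda(G))$ on the right. *)

(* Defs.v *)
From HB Require Import structures.
From mathcomp Require Import all_boot all_order all_algebra all_fingroup.
From mathcomp Require Import all_classical all_reals all_analysis.

Set Implicit Arguments.
Unset Strict Implicit.
Unset Printing Implicit Defensive.

Import Order.TTheory GRing.Theory Num.Theory.
Import numFieldNormedType.Exports.

Local Open Scope classical_set_scope.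
Local Open Scope ring_scope.

(* Encoded by finite functions so that the graphs of a given order form a
   finite type. *)
Section Graph.
Variable n : nat.

Definition simple_adj (e : {ffun 'I_n * 'I_n -> bool}) : bool :=
  [forall x, ~~ e (x, x)] && [forall x, forall y, e (x, y) == e (y, x)].

Record graph := Graph { adj_fun : {ffun 'I_n * 'I_n -> bool};
                        _ : simple_adj adj_fun }.

HB.instance Definition _ := [isSub for adj_fun].
HB.instance Definition _ := [Finite of graph by <:].

Definition adj (G : graph) : rel 'I_n := fun x y => adj_fun G (x, y).

End Graph.

Lemma adj_irr n (G : graph n) : irreflexive (adj G).
Proof.
by move=> x; have /andP[/forallP h _] := valP G; apply/negbTE/(h x).
Qed.

Lemma adj_sym n (G : graph n) : symmetric (adj G).
Proof.
move=> x y; have /andP[_ /forallP/(_ x)/forallP/(_ y)/eqP h] := valP G.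
exact: h.
Qed.

(* Pulling back adjacency along f covers blow-ups (f arbitrary, with parts the
   fibres of f), induced subgraphs (f injective) and relabellings (f
   bijective). *)
Definition pull_fun k n (G : graph n) (f : 'I_k -> 'I_n) :=
  [ffun p : 'I_k * 'I_k => adj G (f p.1) (f p.2)].

Lemma pull_subproof k n (G : graph n) (f : 'I_k -> 'I_n) :
  simple_adj (pull_fun G f).
Proof.
apply/andP; split; first by apply/forallP => x; rewrite ffunE adj_irr.
by apply/forallP => x; apply/forallP => y; rewrite !ffunE adj_sym.
Qed.

Definition pull k n (G : graph n) (f : 'I_k -> 'I_n) : graph k :=
  Graph (pull_subproof G f).

Lemma adj_pull k n (G : graph n) (f : 'I_k -> 'I_n) x y :
  adj (pull G f) x y = adj G (f x) (f y).
Proof. by rewrite /adj ffunE. Qed.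

Definition del_vertex n (G : graph n) (i : 'I_n) : graph n.-1 :=
  pull G (lift i).

Definition twin_free n (G : graph n) : Prop :=
  forall x y, adj G x =1 adj G y -> x = y.

Definition graph_iso k (H H' : graph k) : bool :=
  [exists s : {perm 'I_k}, pull H s == H'].

Lemma graph_iso_refl k (H : graph k) : graph_iso H H.
Proof.
apply/existsP; exists 1%g; apply/eqP/val_inj/ffunP => -[x y].
by rewrite ffunE !perm1.
Qed.

Lemma graph_iso_sym k (H H' : graph k) : graph_iso H H' -> graph_iso H' H.
Proof.
case/existsP => s /eqP <-; apply/existsP; exists s^-1%g.
by apply/eqP/val_inj/ffunP => -[x y]; rewrite ffunE adj_pull !permKV.
Qed.

Lemma graph_iso_trans k : transitive (@graph_iso k).
Proof.
move=> H2 H1 H3 /existsP[s /eqP <-] /existsP[t /eqP <-].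
apply/existsP; exists (t * s)%g; apply/eqP/val_inj/ffunP => -[x y].
by rewrite !ffunE adj_pull !permM.
Qed.

(* [choose P x] depends only on the extent of P, so this selects exactly one
   graph in each isomorphism class. *)
Definition is_repr k (H : graph k) : bool := choose (graph_iso H) H == H.

Lemma is_reprP k (H : graph k) :
  exists! H0 : graph k, is_repr H0 /\ graph_iso H H0.
Proof.
have e (H1 H2 : graph k) : graph_iso H1 H2 ->
    choose (graph_iso H1) H1 = choose (graph_iso H2) H2.
  move=> h; have E : graph_iso H1 =1 graph_iso H2.
    move=> H3; apply/idP/idP; apply: graph_iso_trans => //.
    exact: graph_iso_sym.
  rewrite (eq_choose E); apply: choose_id; last exact: graph_iso_refl.
  by rewrite -E graph_iso_refl.
have h : graph_iso H (choose (graph_iso H) H).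
  exact/chooseP/graph_iso_refl.
exists (choose (graph_iso H) H); split.
  by split=> //; rewrite /is_repr -(e _ _ h).
by move=> H' [/eqP r h']; rewrite (e _ _ h') r.
Qed.

Definition induces k n (H : graph k) (G : graph n) (S : {set 'I_n}) : bool :=
  [exists f : {ffun 'I_k -> 'I_n},
    [&& injectiveb f, (f @: [set: 'I_k])%SET == S & pull G f == H]].

Definition P_count k n (H : graph k) (G : graph n) : nat :=
  #|[pred S : {set 'I_n} | induces H G S]|.

(* Families of graphs of all orders. *)
Definition graph_class := forall n : nat, set (graph n).

Definition Forb (F : graph_class) : graph_class := fun n =>
  [set G | forall k (H : graph k), F k H -> P_count H G = 0%N].

Arguments Forb F n _ : clear implicits.

Definition blowups m (B : graph m) : graph_class := fun n =>
  [set G | exists f : 'I_n -> 'I_m, G = pull B f].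

Arguments blowups {m} B n _.

(* The representatives of the isomorphism classes of admissible graphs of
   order k. *)
Definition G0 (F : graph_class) (k : nat) : finType :=
  {H : graph k | is_repr H && `[< Forb F k H >]}.

Section Lambda.
Variables (R : realType) (F : graph_class) (k : nat) (gamma : G0 F k -> R).

Definition Lambda n (G : graph n) : R :=
  \sum_(H : G0 F k) gamma H * (P_count (val H) G)%:R.

Definition lambda n (G : graph n) : R := Lambda G / 'C(n, k)%:R.

(* The set is finite, so the supremum is a maximum when it is nonempty. *)
Definition lambda_max (n : nat) : R :=
  sup [set lambda G | G in Forb F n].

Definition lambda_lim : R := limn lambda_max.

Definition simplex (m : nat) : set ('I_m -> R) :=
  [set x | (forall i, 0 <= x i) /\ \sum_i x i = 1].

(* The parts f_n^-1(i) have sizes x_i * n + O(1). *)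
Definition part_sizes m (x : 'I_m -> R) (N : nat -> nat)
    (f : forall n, 'I_(N n) -> 'I_m) : Prop :=
  exists K : R, forall n i,
    `| #|[pred v | f n v == i]|%:R - x i * n%:R | <= K.

(* The common limit of lambda along all blow-ups of B with part ratios x. *)
Definition lambda_at m (B : graph m) (x : 'I_m -> R) : R :=
  xget 0 [set l | forall (N : nat -> nat) (f : forall n, 'I_(N n) -> 'I_m),
    part_sizes x f -> lambda (pull B (f n)) @[n --> \oo] --> l].

(* Extended-real valued so that the graph without vertices, whose simplex is
   empty, gets the value -oo; for m > 0 the value is a real number. *)
Definition lambda_blowups m (B : graph m) : \bar R :=
  ereal_sup [set (lambda_at B x)%:E | x in @simplex m].

Definition lambda_minimal m (B : graph m) : Prop :=
  forall i : 'I_m, (lambda_blowups (del_vertex B i) < lambda_blowups B)%E.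

Definition changes n (G G' : graph n) : nat :=
  #|[pred p : 'I_n * 'I_n |
      (p.1 < p.2)%N && (adj G p.1 p.2 != adj G' p.1 p.2)]|.

(* The set is finite, so the infimum is a minimum when it is nonempty. *)
Definition edit_dist m (B : graph m) n (G : graph n) : R :=
  inf [set (changes G G')%:R | G' in blowups B n] / 'C(n, 2)%:R.

Definition robustly_stable m (B : graph m) : Prop :=
  exists2 C : R, 0 < C & forall n (G : graph n), Forb F n G -> C <= n%:R ->
    edit_dist B G <= C * Num.max n%:R^-1 (lambda_max n - lambda G).

Definition perfectly_stable m (B : graph m) : Prop :=
  exists2 C : R, 0 < C & forall n (G : graph n), Forb F n G -> C <= n%:R ->
    edit_dist B G <= C * (lambda_max n - lambda G).

End Lambda.

(* Main.v *)
(* Let [G] be admissible and let [G0] be a closest blow-up of [B] on the same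
   vertices, differing from [G] in [q] ordered pairs.  Twin-freeness makes
   every blow-up of [G] admissible, and by averaging over choices of clones a
   blow-up of [G] with weights [y_v >= b / n] is still at edit distance at
   least about [b^2 q / n^2] from [B()].  Applying robust stability to larger
   and larger such blow-ups kills its [1/n] term and gives
   [lambda(B()) - lambda(G(y)) >= c q / n^2].  Unless [lambda(n) - lambda(G)]
   is bounded below (when robust stability suffices), the part ratios of [G0]
   are close to a maximiser [x] of [lambda(B(.))], whose coordinates are
   bounded away from 0 by minimality and compactness; so one can choose [y]
   nearly uniform with part weights exactly [x], and then
   [lambda(G0(y)) = lambda(B())].  Passing from [y]-weighted independent samples
   to uniform distinct ones changes [lambda(G0(y)) - lambda(G(y))] only by
   [o(q / n^2)], since only samples hitting a wrong pair matter.  Hence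
   [lambda(n) - lambda(G) >= lambda(G0) - lambda(G) >= c' q / n^2]. *)
Require Import Defs.
From mathcomp Require Import all_boot all_order all_algebra.
From mathcomp Require Import all_classical all_reals all_analysis.
From mathcomp Require Import ring lra zify.

Import Order.TTheory GRing.Theory Num.Theory.
Import numFieldNormedType.Exports.

Local Open Scope classical_set_scope.
Local Open Scope ring_scope.

Set Implicit Arguments.
Unset Strict Implicit.
Unset Printing Implicit Defensive.

(** * Counting maps between finite sets *)

Lemma leq_card_pred (A B : finType) (P : pred A) (Q : pred B) (g : A -> B) :
  {in P &, injective g} -> (forall x, P x -> Q (g x)) -> (#|P| <= #|Q|)%N.
Proof.
move=> gI PQ; rewrite -(@card_in_image _ _ g P gI); apply: subset_leq_card.
by apply/fintype.subsetP => _ /fintype.imageP[x Px ->]; apply: PQ.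
Qed.

Lemma card_pred_fst (A B : finType) (P : pred A) :
  #|[pred p : A * B | P p.1]| = (#|P| * #|B|)%N.
Proof.
by rewrite -(cardX P (mem B)); apply: eq_card => -[a b]; rewrite !inE andbT.
Qed.

Section Counting.
Variables (I T : finType).
Implicit Types (f : {ffun I -> T}) (P : pred {ffun I -> T}).

Definition upd f (i : I) (t : T) : {ffun I -> T} :=
  [ffun x => if x == i then t else f x].

Lemma upd_eq f i t : upd f i t i = t.
Proof. by rewrite ffunE eqxx. Qed.

Lemma upd_neq f i t x : x != i -> upd f i t x = f x.
Proof. by rewrite ffunE => /negbTE ->. Qed.

(** Overwriting [f] at [i] and [j] by a free pair while recording the old values is injective: the
    values of a random map at two distinct points form a uniform pair. *)
Lemma card_pair_le (i j : I) (Q : pred (T * T)) : i != j ->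
  (#|[pred f : {ffun I -> T} | Q (f i, f j)]| * #|T| ^ 2
    <= #|Q| * #|T| ^ #|I|)%N.
Proof.
move=> ij; rewrite -card_ffun expnS expn1 -!card_prod -!card_pred_fst.
pose g (p : {ffun I -> T} * (T * T)) :=
  ((p.1 i, p.1 j), upd (upd p.1 i p.2.1) j p.2.2).
apply: (@leq_card_pred _ _ _ _ g); last first.
  by move=> [f [u v]] //.
move=> p p'; case: p p' => f [u v] [f' [u' v']] _ _ [/= fi fj /ffunP e].
have := e j; rewrite !upd_eq => ->.
have := e i; rewrite !(upd_neq _ _ ij) !upd_eq => ->.
congr pair; apply/ffunP => x.
have [->//|xi] := eqVneq x i; have [->//|xj] := eqVneq x j.
by have := e x; rewrite !upd_neq.
Qed.

(** [P] ignores the value at [b], so a resampled value equals [f a] only once in [#|T|] times; the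
    overwritten [f b] is read off from [f a]. *)
Lemma card_collision_le (a b : I) P : a != b ->
  (forall f t, P f -> P (upd f b t)) ->
  (#|[pred f | P f && (f a == f b)]| * #|T| <= #|P|)%N.
Proof.
move=> ab PP; rewrite -card_pred_fst.
apply: (@leq_card_pred _ _ _ _ (fun p => upd p.1 b p.2)); last first.
  by move=> [f t] /andP[/= Pf _]; apply: PP.
move=> p p'; case: p p' => f t [f' t'] /andP[_ /eqP h] /andP[_ /eqP h'] /=.
rewrite /= in h h' * => /ffunP e.
have := e b; rewrite !upd_eq => ->; congr pair; apply/ffunP => x.
have [->|xb] := eqVneq x b; last by have := e x; rewrite !upd_neq.
by rewrite -h -h'; have := e a; rewrite !upd_neq.
Qed.

Lemma card_exists_pair_le (P : I -> I -> pred {ffun I -> T}) :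
  (#|[pred f | [exists i, exists j, P i j f]]|
    <= \sum_i \sum_j #|P i j|)%N.
Proof.
rewrite -sum1_card big_mkcond /=.
under [leqRHS]eq_bigr do under eq_bigr do rewrite -sum1_card big_mkcond /=.
under [leqRHS]eq_bigr do rewrite exchange_big /=.
rewrite exchange_big /=; apply: leq_sum => f _.
rewrite inE; case: existsP => //= -[i /existsP[j Pij]].
by rewrite (bigD1 i)//= (bigD1 j)//= unfold_in Pij -addnA.
Qed.

Lemma sum_pair_le (c d e : nat) (F : I -> I -> nat) :
  (forall i j, F i j * c <= d * e)%N ->
  ((\sum_i \sum_j F i j) * c <= #|I| ^ 2 * (d * e))%N.
Proof.
move=> h; rewrite big_distrl /=.
rewrite (leq_trans (n := (\sum_(i : I) #|I| * (d * e))%N)) //; last first.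
  by rewrite sum_nat_const expnS expn1 mulnA.
apply: leq_sum => i _; rewrite big_distrl /= -[leqRHS]sum_nat_const.
by apply: leq_sum => j _.
Qed.

Lemma card_noninj_le :
  (#|[pred f : {ffun I -> T} | ~~ injectiveb f]| * #|T|
    <= #|I| ^ 2 * #|T| ^ #|I|)%N.
Proof.
pose P a b := [pred f : {ffun I -> T} | (a != b) && (f a == f b)].
apply: (@leq_trans (#|[pred f | [exists a, exists b, P a b f]]| * #|T|)%N).
  rewrite leq_mul2r subset_leq_card ?orbT//; apply/fintype.subsetP => f.
  rewrite !inE => /injectivePn[a [b ab fab]]; apply/existsP; exists a.
  by apply/existsP; exists b; rewrite inE ab fab /=.
rewrite (leq_trans (leq_mul (card_exists_pair_le _) (leqnn _)))//.
rewrite -[(#|T| ^ _)%N]mul1n sum_pair_le// => a b; rewrite mul1n.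
have [->|ab] := eqVneq a b.
  by rewrite [#|_|](_ : _ = 0)%N ?mul0n//; apply: eq_card0 => f; rewrite !inE eqxx.
apply: leq_trans (_ : #|predT : pred {ffun I -> T}| <= _)%N; last first.
  by rewrite card_ffun.
have := @card_collision_le a b predT ab (fun _ _ _ => isT).
apply: leq_trans; rewrite leq_mul2r; apply/orP; right.
by apply: subset_leq_card; apply/fintype.subsetP => f; rewrite !inE => /andP[].
Qed.

Definition bad (Q : rel T) f := [exists i, exists j, Q (f i) (f j)].

Variable (Q : rel T).
Hypothesis Qirr : irreflexive Q.
Let q := #|[pred p : T * T | Q p.1 p.2]|.

Let card_Q i j :
  (#|[pred f : {ffun I -> T} | Q (f i) (f j)]| * #|T| ^ 2
    <= q * #|T| ^ #|I|)%N.
Proof.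
have [->|ij] := eqVneq i j.
  by rewrite [#|_|](_ : _ = 0)%N// ; apply: eq_card0 => f; rewrite !inE Qirr.
exact: (@card_pair_le _ _ [pred p : T * T | Q p.1 p.2]).
Qed.

Lemma card_bad_le : (#|[pred f | bad Q f]| * #|T| ^ 2
    <= #|I| ^ 2 * (q * #|T| ^ #|I|))%N.
Proof.
pose P i j := [pred f : {ffun I -> T} | Q (f i) (f j)].
rewrite (leq_trans (leq_mul (card_exists_pair_le P) (leqnn _)))//.
exact: sum_pair_le.
Qed.

(** Compared with [card_bad_le], the collision gains one more factor [#|T|], because it can be taken
    to involve a position independent of the wrong pair. *)
Lemma card_bad_noninj_le :
  (#|[pred f | bad Q f && ~~ injectiveb f]| * #|T| ^ 3
    <= #|I| ^ 4 * (q * #|T| ^ #|I|))%N.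
Proof.
pose P i j a b := [pred f : {ffun I -> T} |
  [&& Q (f i) (f j), a != b, b != i, b != j & f a == f b]].
pose P2 i j := [pred f | [exists a, exists b, P i j a b f]].
apply: (@leq_trans (#|[pred f | [exists i, exists j, P2 i j f]]| * #|T| ^ 3)%N).
  rewrite leq_mul2r subset_leq_card ?orbT//; apply/fintype.subsetP => f.
  rewrite !inE => /andP[/existsP[i /existsP[j Qij]]].
  move=> /injectivePn[a [b ab fab]]; apply/existsP; exists i.
  apply/existsP; exists j; apply/existsP.
  (* Irreflexivity of [Q] prevents the collision from being between [i] and [j], so one colliding
     position lies outside both; that one plays the role of [b]. *)
  have fij : f i != f j by apply/eqP => e; rewrite e Qirr in Qij.
  have [/andP[bi bj]|] := boolP ((b != i) && (b != j)).
    by exists a; apply/existsP; exists b; rewrite inE Qij ab bi bj fab /=.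
  move=> h; exists b; apply/existsP; exists a.
  rewrite inE Qij (eq_sym b a) ab fab eqxx /= andbT.
  apply/andP; split; apply/eqP => e; subst a; move: h;
    rewrite !(eq_sym b) ab /= ?andbT negbK => /eqP e.
    by rewrite e -fab eqxx in fij.
  by rewrite e fab eqxx in fij.
rewrite (leq_trans (leq_mul (card_exists_pair_le _) (leqnn _)))//.
rewrite (_ : 4 = 2 + 2)%N// expnD -mulnA sum_pair_le// => i j.
rewrite (leq_trans (leq_mul (card_exists_pair_le _) (leqnn _)))//.
apply: sum_pair_le => a b.
rewrite expnS mulnA.
apply: leq_trans (card_Q i j); rewrite leq_mul2r; apply/orP; right.
have [/and3P[ab bi bj]|h] := boolP [&& a != b, b != i & b != j].
  have := @card_collision_le a b [pred f : {ffun I -> T} | Q (f i) (f j)] ab.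
  move=> h; apply: leq_trans (h _); last first.
    by move=> f t /=; rewrite !upd_neq// eq_sym.
  rewrite leq_mul2r subset_leq_card ?orbT//; apply/fintype.subsetP => f.
  by rewrite !inE => /and5P[-> _ _ _ ->].
rewrite [X in (X * _)%N](_ : _ = 0)%N//; apply: eq_card0 => f; rewrite !inE.
by apply: contraNF h => /and5P[_ -> -> -> _].
Qed.

End Counting.

(** * Pullbacks and admissibility *)

Lemma graph_eqP n (G G' : graph n) : adj G =2 adj G' -> G = G'.
Proof. by move=> e; apply/val_inj/ffunP => -[x y]; apply: e. Qed.

Lemma pull_comp a b c (G : graph c) (g : 'I_b -> 'I_c) (f : 'I_a -> 'I_b) :
  pull (pull G g) f = pull G (g \o f).
Proof. by apply: graph_eqP => x y; rewrite !adj_pull. Qed.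

Lemma eq_pull a b (G : graph b) (f g : 'I_a -> 'I_b) :
  f =1 g -> pull G f = pull G g.
Proof. by move=> e; apply: graph_eqP => x y; rewrite !adj_pull !e. Qed.

(* Copies of a twin-free graph cannot use two vertices with the same image
   under [g]. *)
Lemma Forb_pull (F : graph_class) :
  (forall n (H : graph n), F n H -> twin_free H) ->
  forall n N (G : graph n) (g : 'I_N -> 'I_n), Forb F n G -> Forb F N (pull G g).
Proof.
move=> tf n N G g FG j H FH.
apply/eqP; rewrite -leqn0 leqNgt; apply/negP => /card_gt0P[S].
rewrite inE => /existsP[f /and3P[/injectiveP fI _ /eqP fH]].
suff : (0 < P_count H G)%N by rewrite FG.
apply/card_gt0P; pose h := [ffun x => g (f x)].
have hH : pull G h = H.
  by rewrite -fH pull_comp; apply: eq_pull => x; rewrite ffunE.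
exists (h @: [set: 'I_j])%SET; rewrite inE; apply/existsP; exists h.
rewrite eqxx hH eqxx !andbT; apply/injectiveP => x y hxy.
by apply: (tf _ _ FH) => z; rewrite -hH !adj_pull hxy.
Qed.

(** * The density [lambda] as an average over injective samples, and its limit *)

Section Density.
Variables (R : realType) (F : graph_class) (k : nat) (gamma : G0 F k -> R).
Implicit Types n : nat.

Definition gsum : R := \sum_H `|gamma H|.

Lemma gsum_ge0 : 0 <= gsum.
Proof. exact: sumr_ge0. Qed.

(** [pull G f] has order [k], so its whole vertex set is the only candidate for a copy of [H] and
    the count is 0 or 1. *)
Lemma induces_imset n (H : graph k) (G : graph n) (f : {ffun 'I_k -> 'I_n}) :
  injective f -> P_count H (pull G f) = induces H G (f @: [set: 'I_k])%SET.
Proof.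
move=> fI; have imT (g : {ffun 'I_k -> 'I_k}) : injective g ->
    (g @: [set: 'I_k])%SET = [set: 'I_k]%SET.
  by move=> gI; apply/eqP; rewrite eqEcard finset.subsetT card_imset// leqnn.
have -> : P_count H (pull G f) = induces H (pull G f) [set: 'I_k]%SET.
  rewrite /P_count; case: (boolP (induces H (pull G f) _)) => h /=.
    apply: (fintype.eq_card1 (x := [set: 'I_k]%SET)) => S; rewrite !inE.
    apply/idP/eqP => [/existsP[g /and3P[/injectiveP gI /eqP <- _]]|->//].
    exact: imT.
  apply: eq_card0 => S; rewrite !inE; apply: contraNF h => h.
  case/existsP: (h) => [g /and3P[/injectiveP gI /eqP e _]].
  by move: h; rewrite -e imT.
congr nat_of_bool; apply/existsP/existsP => -[g /and3P[/injectiveP gI /eqP e /eqP gH]].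
  exists [ffun x => f (g x)]; apply/and3P; split.
  - by apply/injectiveP => x y; rewrite !ffunE => /fI/gI.
  - have <- : (f @: (g @: [set: 'I_k]) = [ffun x => f (g x)] @: [set: 'I_k])%SET.
      by rewrite -imset_comp; apply: eq_imset => x; rewrite ffunE.
    by rewrite e.
  - by rewrite -gH pull_comp; apply/eqP/eq_pull => x; rewrite ffunE.
have /fin_all_exists[h hE] x : exists y, f y = g x.
  have : g x \in (f @: [set: 'I_k])%SET by rewrite -e imset_f.
  by move=> /imsetP[y _ ->]; exists y.
have hI : injective [ffun x => h x].
  by move=> x y; rewrite !ffunE => /(congr1 f); rewrite !hE => /gI.
exists [ffun x => h x]; apply/and3P; split; first exact/injectiveP.
  by rewrite imT.
by rewrite -gH pull_comp; apply/eqP/eq_pull => x; rewrite /= ffunE hE.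
Qed.

Lemma sum_induces n (H : graph k) (G : graph n) :
  (\sum_(f : {ffun 'I_k -> 'I_n} | injectiveb f) P_count H (pull G f)
    = P_count H G * k`!)%N.
Proof.
rewrite (partition_big (fun f : {ffun 'I_k -> 'I_n} => (f @: [set: 'I_k])%SET) predT)//=.
rewrite [P_count H G]/P_count -sum1_card big_distrl /= [RHS]big_mkcond /=.
apply: eq_bigr => S _; rewrite inE mul1n.
under eq_bigr => f /andP[/injectiveP fI /eqP e] do rewrite induces_imset// e.
rewrite sum_nat_const; case: (boolP (induces H G S)) => [/existsP[g]|]; last by rewrite muln0.
move=> /and3P[/injectiveP gI /eqP e _]; rewrite muln1.
have cS : #|S| = k by rewrite -e card_imset// cardsT card_ord.
have := @card_inj_ffuns_on 'I_k 'I_n (mem S).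
rewrite card_ord cS ffactnn => <-; rewrite cardsE; apply: eq_card => f.
rewrite [LHS]unfold_in [RHS]unfold_in andbC.
case: (boolP (injectiveb f)) => [/injectiveP fI|]; rewrite ?andbF ?andbT//.
apply/eqP/ffun_onP => [<- x|h]; first by rewrite imset_f.
apply/eqP; rewrite eqEcard card_imset// cardsT card_ord cS leqnn andbT.
by apply/fintype.subsetP => _ /imsetP[x _ ->]; apply: h.
Qed.

Lemma Lambda_sum_inj n (G : graph n) :
  \sum_(f : {ffun 'I_k -> 'I_n} | injectiveb f) Lambda gamma (pull G f)
    = Lambda gamma G * k`!%:R.
Proof.
rewrite exchange_big /= /Lambda mulr_suml; apply: eq_bigr => H _.
by rewrite -mulr_sumr -mulrA -natrM -sum_induces natr_sum.
Qed.

Lemma card_injffun n : #|[pred f : {ffun 'I_k -> 'I_n} | injectiveb f]| = (n ^_ k)%N.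
Proof. by rewrite -cardsE card_inj_ffuns !card_ord. Qed.

(** The division-free form of [lambda]; it stays valid for [n < k], where both sides vanish. *)
Lemma lambda_sum_inj n (G : graph n) :
  (n ^_ k)%:R * lambda gamma G =
    \sum_(f : {ffun 'I_k -> 'I_n} | injectiveb f) Lambda gamma (pull G f).
Proof.
have [C0|C0] := eqVneq 'C(n, k) 0%N.
  have n0 : (n ^_ k)%N = 0%N by rewrite -bin_ffact C0.
  rewrite n0 mul0r big1// => f fI; have := card0_eq (etrans (card_injffun n) n0) f.
  by rewrite inE fI.
rewrite Lambda_sum_inj -bin_ffact natrM /lambda mulrC mulrA divfK//.
by rewrite pnatr_eq0.
Qed.

Lemma Lambda_le (H : graph k) : `|Lambda gamma H| <= gsum.
Proof.
rewrite (le_trans (ler_norm_sum _ _ _))// ler_sum// => H' _.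
rewrite normrM ler_piMr// normr_nat lern1.
have -> : H = pull H [ffun x => x].
  by apply: graph_eqP => x y; rewrite adj_pull !ffunE.
rewrite induces_imset ?leq_b1// => x y; by rewrite !ffunE.
Qed.

Lemma sum_Lambda_le n (G : graph n) (P : pred {ffun 'I_k -> 'I_n}) :
  `|\sum_(f | P f) Lambda gamma (pull G f)| <= gsum * #|[pred f | P f]|%:R.
Proof.
rewrite (le_trans (ler_norm_sum _ _ _))// -sum1_card natr_sum mulr_sumr.
by apply: ler_sum => f _; rewrite mulr1 Lambda_le.
Qed.

Lemma lambda_le n (G : graph n) : `|lambda gamma G| <= gsum.
Proof.
have [C0|C0] := posnP 'C(n, k).
  by rewrite /lambda C0 invr0 mulr0 normr0 gsum_ge0.
have n0 : 0 < (n ^_ k)%:R :> R by rewrite ltr0n -bin_ffact muln_gt0 C0 fact_gt0.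
rewrite -(ler_pM2l n0) -[X in X * `|_|]ger0_norm ?ler0n// -normrM.
by rewrite lambda_sum_inj (le_trans (sum_Lambda_le _ _))// card_injffun mulrC.
Qed.

Lemma lambda_max_ge n (G : graph n) :
  Forb F n G -> lambda gamma G <= lambda_max gamma n.
Proof.
move=> FG; apply: ub_le_sup; last by exists G.
by exists gsum => _ [H _ <-]; rewrite (le_trans _ (lambda_le H))// ler_norm.
Qed.

(** An injective sample misses exactly [n.+2 - k] vertices, so it survives in that many
    vertex-deleted subgraphs. *)
Lemma lambda_del n (G : graph n.+2) : (k <= n.+1)%N ->
  (n.+2)%:R * lambda gamma G = \sum_v lambda gamma (pull G (lift v)).
Proof.
move=> kn; have n0 : (n.+1 ^_ k)%:R != 0 :> R.
  by rewrite pnatr_eq0 -lt0n ffact_gt0.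
apply: (mulfI n0); rewrite mulr_sumr.
under [RHS]eq_bigr do rewrite lambda_sum_inj.
have E (v : 'I_n.+2) :
    \sum_(f : {ffun 'I_k -> 'I_n.+1} | injectiveb f) Lambda gamma (pull (pull G (lift v)) f)
    = \sum_(f : {ffun 'I_k -> 'I_n.+2} | injectiveb f && [forall x, f x != v])
        Lambda gamma (pull G f).
  (* Samples avoiding [v] are the lifted samples of the vertex-deleted graph; on them [unlift]
     succeeds, so the default [ord0] is never reached. *)
  rewrite [RHS](reindex_onto (fun f : {ffun 'I_k -> 'I_n.+1} => [ffun x => lift v (f x)])
    (fun f : {ffun 'I_k -> 'I_n.+2} => [ffun x => odflt ord0 (unlift v (f x))]))/=.
    apply: eq_big => [f|f _]; last first.
      by rewrite pull_comp; congr Lambda; apply: eq_pull => x; rewrite /= ffunE.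
    apply/idP/idP => [/injectiveP fI|/andP[/andP[/injectiveP fI _] _]]; last first.
      by apply/injectiveP => x y e; apply: fI; rewrite !ffunE e.
    rewrite -andbA; apply/and3P; split.
    - by apply/injectiveP => x y; rewrite !ffunE => /lift_inj/fI.
    - by apply/forallP => x; rewrite ffunE eq_sym neq_lift.
    - by apply/eqP/ffunP => x; rewrite !ffunE liftK.
  move=> f /andP[_ /forallP fv]; apply/ffunP => x; rewrite !ffunE.
  by have := fv x; rewrite eq_sym => /unlift_some[y -> ->].
rewrite (eq_bigr _ (fun v _ => E v)).
rewrite (exchange_big_dep (fun f : {ffun 'I_k -> 'I_n.+2} => injectiveb f))/=;
  last by move=> v f _ /andP[].
have C (f : {ffun 'I_k -> 'I_n.+2}) : injectiveb f ->
    \sum_(v | injectiveb f && [forall x, f x != v]) Lambda gamma (pull G f)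
    = Lambda gamma (pull G f) * (n.+2 - k)%:R.
  move=> fI; rewrite (eq_bigl (mem (~: (f @: [set: 'I_k]))%SET)); last first.
    move=> v; rewrite fI /= finset.in_setC; apply/forallP/negP => [h /imsetP[x _ e]|h x].
      by have := h x; rewrite e eqxx.
    by apply/eqP => e; apply: h; rewrite -e imset_f.
  rewrite sumr_const cardsCs finset.setCK card_imset; last exact/injectiveP.
  by rewrite cardsT !card_ord mulr_natr.
rewrite (eq_bigr _ C) -mulr_suml -lambda_sum_inj.
by rewrite [RHS]mulrAC -natrM -ffactnSr ffactSS natrM; ring.
Qed.

Hypothesis Ftf : forall n (H : graph n), @F n H -> twin_free H.

Lemma Forb_nonempty n : (exists G : graph n, Forb F n G) ->
  has_sup [set lambda gamma G | G in Forb F n].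
Proof.
move=> [G FG]; split; first by exists (lambda gamma G), G.
by exists gsum => _ [H _ <-]; rewrite (le_trans _ (lambda_le H))// ler_norm.
Qed.

Hypothesis Fne : forall n, exists G : graph n, Forb F n G.

(** By [lambda_del], [lambda G] is the mean over the vertex-deleted subgraphs, which are again
    admissible. *)
Lemma lambda_max_nincr n : (k <= n.+1)%N ->
  lambda_max gamma n.+2 <= lambda_max gamma n.+1.
Proof.
move=> kn; apply: ge_sup; first by have [] := Forb_nonempty (Fne n.+2).
move=> _ [G FG <-]; have n0 : 0 < n.+2%:R :> R by rewrite ltr0n.
rewrite -(ler_pM2l n0) lambda_del//.
rewrite (_ : n.+2%:R * _ = \sum_(v < n.+2) lambda_max gamma n.+1).
  by apply: ler_sum => v _; apply/lambda_max_ge/Forb_pull.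
by rewrite sumr_const card_ord mulr_natl.
Qed.

Lemma lambda_max_cvg : lambda_max gamma n @[n --> \oo] --> lambda_lim gamma.
Proof.
(* Monotonicity is only known from some order on, hence the shift by [k.+1]. *)
have ni : nonincreasing_seq [sequence lambda_max gamma (n + k.+1)%N]_n.
  apply/nonincreasing_seqP => n /=.
  by rewrite addSn addnS lambda_max_nincr// leqW// leq_addl.
have lb : has_lbound (range [sequence lambda_max gamma (n + k.+1)%N]_n).
  exists (- gsum) => _ [n _ <-] /=.
  have [G FG] := Fne (n + k.+1); rewrite (le_trans _ (lambda_max_ge FG))// lerNl.
  by rewrite (le_trans _ (lambda_le G))// -normrN ler_norm.
have := nonincreasing_cvgn ni lb; rewrite cvg_shiftn => /cvgP.
exact.
Qed.

Lemma lambda_lim_le n : (k <= n)%N -> (0 < n)%N ->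
  lambda_lim gamma <= lambda_max gamma n.
Proof.
move=> kn n0; apply: (cvgr_to_le lambda_max_cvg).
exists n => // N /=; elim: N => [|N IH]; first by rewrite leqn0 => /eqP ->.
rewrite leq_eqVlt => /predU1P[<-//|]; rewrite ltnS => nN.
apply: le_trans (IH nN); case: N nN {IH} => [|N nN].
  by rewrite leqn0 => /eqP n00; rewrite n00 in n0.
by apply: lambda_max_nincr; apply: leq_trans nN.
Qed.

End Density.

(** * Wrong pairs of two graphs on the same vertices *)

Definition wrong n (G G' : graph n) : rel 'I_n :=
  fun x y => adj G x y != adj G' x y.

(** Pairs are ordered here, unlike in [changes], to match the counting of samples. *)
Definition nwrong n (G G' : graph n) : nat :=
  #|[pred p : 'I_n * 'I_n | wrong G G' p.1 p.2]|.

Lemma wrong_irr n (G G' : graph n) : irreflexive (wrong G G').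
Proof. by move=> x; rewrite /wrong !adj_irr. Qed.

Lemma nwrongE n (G G' : graph n) : nwrong G G' = (changes G G').*2.
Proof.
rewrite -addnn /nwrong /changes.
rewrite -(cardID [pred p : 'I_n * 'I_n | (p.1 < p.2)%N]); congr addn.
  by apply: eq_card => -[x y]; rewrite !inE andbC.
pose sw (p : 'I_n * 'I_n) := (p.2, p.1).
have swI : injective sw by move=> [x y] [x' y'] [-> ->].
transitivity #|[predI codom sw & [pred p : 'I_n * 'I_n |
  (p.1 < p.2)%N && wrong G G' p.1 p.2]]|; last first.
  apply: eq_card => -[x y]; rewrite !inE [_ \in codom _](_ : _ = true)//.
  exact: (codom_f sw (y, x)).
rewrite -(card_preim swI); apply: eq_card => -[x y]; rewrite !inE /= -leqNgt.
rewrite /wrong (adj_sym G y) (adj_sym G' y) ltn_neqAle.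
by case: (eqVneq (y : nat) x) => [/val_inj->|//]; rewrite !adj_irr /= ?andbF.
Qed.

Lemma sum_card_fibres N n (f : 'I_N -> 'I_n) :
  (\sum_i #|[pred v | f v == i]|)%N = N.
Proof.
rewrite -[RHS]card_ord -sum1_card (partition_big f predT)//=.
by apply: eq_bigr => i _; rewrite sum1_card.
Qed.

(** * Weighted densities as limits of densities of blow-ups *)

Section WeightedDensity.
Variables (R : realType) (F : graph_class) (k : nat) (gamma : G0 F k -> R).
Local Notation gsum := (gsum gamma).

(* The limit density of the blow-ups of [G] with part ratios [y]. *)
Definition dens n (G : graph n) (y : 'I_n -> R) : R :=
  \sum_(f : {ffun 'I_k -> 'I_n}) (\prod_i y (f i)) * Lambda gamma (pull G f).

Definition push n m (f : 'I_n -> 'I_m) (y : 'I_n -> R) (j : 'I_m) : R :=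
  \sum_(v | f v == j) y v.

Lemma eq_dens n (G : graph n) (y z : 'I_n -> R) :
  y =1 z -> dens G y = dens G z.
Proof.
by move=> e; apply: eq_bigr => f _; congr (_ * _); apply: eq_bigr => i _.
Qed.

(** A sample from [y] followed by [f] is a sample from the part weights [push f y]; samples are
    grouped by the parts they visit. *)
Lemma dens_pull n m (B : graph m) (f : 'I_n -> 'I_m) (y : 'I_n -> R) :
  dens (pull B f) y = dens B (push f y).
Proof.
rewrite /dens (partition_big (fun g : {ffun 'I_k -> 'I_n} => [ffun i => f (g i)]) predT)//=.
apply: eq_bigr => h _.
rewrite /push (bigA_distr_big_dep (fun i v => f v == h i) (fun=> y)) /= mulr_suml.
apply: eq_big => [g|g /eqP <-]; last first.
  by rewrite pull_comp; congr (_ * Lambda _ _); apply: eq_pull => x; rewrite ffunE.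
apply/eqP/familyP => [<- x|e]; first by rewrite unfold_in ffunE.
by apply/ffunP => x; rewrite ffunE; apply/eqP; have := e x; rewrite unfold_in.
Qed.

Lemma dens_unif n (G : graph n) : (0 < n)%N ->
  n%:R ^+ k * dens G (fun=> n%:R^-1) =
    \sum_(f : {ffun 'I_k -> 'I_n}) Lambda gamma (pull G f).
Proof.
move=> n0; rewrite mulr_sumr; apply: eq_bigr => f _.
rewrite big_const iter_mulr mulr1 card_ord mulrA -exprMn divff ?expr1n ?mul1r//.
by rewrite pnatr_eq0 -lt0n.
Qed.

(** Non-injective samples have proportion at most [k ^ 2 / n]. They count twice, as extra terms and
    through the change of normalisation from [n ^_ k] to [n ^ k]. *)
Lemma lambda_dens n (G : graph n) : (0 < n)%N ->
  `|lambda gamma G - dens G (fun=> n%:R^-1)| <= 2 * gsum * (k ^ 2)%:R / n%:R.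
Proof.
move=> n0; have n0' : 0 < n%:R :> R by rewrite ltr0n.
have nk0 : 0 < n%:R ^+ k :> R by rewrite exprn_gt0.
rewrite ler_pdivlMr// -(ler_pM2l nk0) mulrA -[X in X * `|_|](ger0_norm (ltW nk0)).
rewrite -normrM mulrBr dens_unif//.
rewrite (bigID (fun f : {ffun 'I_k -> 'I_n} => injectiveb f))/= -lambda_sum_inj.
set b := #|[pred f : {ffun 'I_k -> 'I_n} | ~~ injectiveb f]|.
have cE : n%:R ^+ k = (n ^_ k)%:R + b%:R :> R.
  rewrite -natrX -natrD; congr (_%:R); rewrite -(card_injffun k n).
  by rewrite cardC card_ffun !card_ord.
rewrite {1}cE mulrDl opprD addrACA subrr add0r.
have := card_noninj_le 'I_k 'I_n; rewrite !card_ord -/b => hb.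
apply: (@le_trans _ _ (2 * gsum * b%:R * n%:R)).
  rewrite ler_pM2r// (le_trans (ler_normB _ _))// normrM normr_nat.
  have := sum_Lambda_le gamma G (fun f => ~~ injectiveb f); rewrite -/b => h.
  have := ler_wpM2l (ler0n R b) (lambda_le gamma G) => h2.
  by rewrite -mulrA mulr2n mulrDl mul1r lerD// [leRHS]mulrC.
rewrite [leRHS]mulrC -!mulrA -natrX -natrM -natrM !ler_wpM2l ?ler_nat ?ler0n//.
exact: gsum_ge0.
Qed.

Lemma Lambda_diff_le n (G G' : graph n) (f : {ffun 'I_k -> 'I_n}) :
  `|Lambda gamma (pull G f) - Lambda gamma (pull G' f)|
    <= 2 * gsum * (bad (wrong G G') f)%:R.
Proof.
have [_|h] := boolP (bad _ f).
  rewrite mulr1 (le_trans (ler_normB _ _))// mulr2n mulrDl mul1r.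
  by rewrite lerD ?Lambda_le.
rewrite (_ : pull G f = pull G' f) ?subrr ?normr0 ?mulr0//.
apply: graph_eqP => x y; rewrite !adj_pull; apply/eqP; apply: contraNT h => h.
by apply/existsP; exists x; apply/existsP; exists y.
Qed.

Lemma card_badR n (G G' : graph n) : (0 < n)%N ->
  #|[pred f : {ffun 'I_k -> 'I_n} | bad (wrong G G') f]|%:R
    <= (k ^ 2)%:R * (nwrong G G')%:R / n%:R ^+ 2 * n%:R ^+ k :> R.
Proof.
move=> n0; have n0' : 0 < n%:R ^+ 2 :> R by rewrite exprn_gt0// ltr0n.
have := card_bad_le 'I_k (wrong_irr G G'); rewrite !card_ord -/(nwrong G G') => h.
by rewrite -(ler_pM2r n0') mulrAC divfK ?gt_eqF// -mulrA -!natrX -!natrM ler_nat.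
Qed.

Lemma card_bad_noninjR n (G G' : graph n) : (0 < n)%N ->
  #|[pred f : {ffun 'I_k -> 'I_n} | bad (wrong G G') f && ~~ injectiveb f]|%:R
    <= (k ^ 4)%:R / n%:R * ((nwrong G G')%:R / n%:R ^+ 2 * n%:R ^+ k) :> R.
Proof.
move=> n0; have n1 : 0 < n%:R :> R by rewrite ltr0n.
have n0' : 0 < n%:R ^+ 3 :> R by rewrite exprn_gt0.
have := card_bad_noninj_le 'I_k (wrong_irr G G'); rewrite !card_ord -/(nwrong G G').
rewrite -(ler_nat R) !natrM !natrX => h.
rewrite -(ler_pM2r n0'); apply: le_trans h _.
by rewrite le_eqVlt; apply/orP; left; apply/eqP; field; rewrite gt_eqF.
Qed.

Lemma dens_diff n (G G' : graph n) : (0 < n)%N ->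
  `|dens G (fun=> n%:R^-1) - dens G' (fun=> n%:R^-1)|
    <= 2 * gsum * (k ^ 2)%:R * ((nwrong G G')%:R / n%:R ^+ 2).
Proof.
move=> n0; have n0' : 0 < n%:R :> R by rewrite ltr0n.
have nk0 : 0 < n%:R ^+ k :> R by rewrite exprn_gt0.
rewrite -(ler_pM2l nk0) -[X in X * `|_|](ger0_norm (ltW nk0)) -normrM mulrBr !dens_unif//.
rewrite -sumrB (le_trans (ler_norm_sum _ _ _))//.
rewrite (le_trans (ler_sum _ (fun f _ => Lambda_diff_le G G' f)))//.
rewrite -mulr_sumr -natr_sum -big_mkcond/= sum1_card.
have := @card_badR n G G' n0; move: (#|_|) => c hc.
rewrite [leRHS]mulrC -!mulrA !ler_wpM2l ?ler0n ?gsum_ge0//.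
by rewrite !mulrA.
Qed.

Lemma near_cvg (T : Type) (Fl : set_system T) {FF : Filter Fl} (f g : T -> R)
    (l : R) : g @ Fl --> l -> (\forall t \near Fl, g t = f t) -> f @ Fl --> l.
Proof. by move=> gl e; apply: (cvg_trans _ gl); apply: near_eq_cvg. Qed.

(** The density is a polynomial in the weights. The arbitrary filter serves both limits along
    blow-ups and continuity in the weights. *)
Lemma dens_cvg (T : Type) (Fl : set_system T) {FF : Filter Fl} n (G : graph n)
    (z : T -> 'I_n -> R) (y : 'I_n -> R) :
  (forall v, z t v @[t --> Fl] --> y v) -> dens G (z t) @[t --> Fl] --> dens G y.
Proof.
move=> zy; apply: cvg_big => [|f _]; first exact: add_continuous.
apply: cvgM; last exact: cvg_cst.
apply: cvg_big => [|i _]; [exact: mul_continuous|exact: zy].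
Qed.

Lemma invn_cvg0 : (t%:R^-1 : R) @[t --> \oo] --> (0 : R).
Proof. by rewrite -cvg_shiftS /=; exact: cvg_harmonic. Qed.

Lemma part_ratio_cvg n (y : 'I_n -> R) (N : nat -> nat)
    (f : forall t, 'I_(N t) -> 'I_n) (i : 'I_n) : part_sizes y f ->
  #|[pred v | f t v == i]|%:R / t%:R @[t --> \oo] --> y i.
Proof.
move=> [K hK]; apply/cvgrPdist_le => e e0.
have K0 : K * t%:R^-1 @[t --> \oo] --> K * 0 by apply: cvgMl_tmp; exact: invn_cvg0.
rewrite mulr0 in K0; near=> t.
have t0 : 0 < t%:R :> R by rewrite ltr0n; near: t; exact: nbhs_infty_gt.
apply: (@le_trans _ _ (K * t%:R^-1)); last first.
  by near: t; apply: (cvgr_le _ K0).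
rewrite ler_pdivlMr// -[X in _ * X]gtr0_norm// -normrM mulrBl divfK ?gt_eqF//.
by rewrite distrC hK.
Unshelve. all: by end_near. Qed.

Lemma order_ratio_cvg n (y : 'I_n -> R) (N : nat -> nat)
    (f : forall t, 'I_(N t) -> 'I_n) : simplex y -> part_sizes y f ->
  (N t)%:R / t%:R @[t --> \oo] --> (1 : R).
Proof.
move=> [_ y1] pf; rewrite -[X in _ --> X]y1.
rewrite (_ : (fun t => _) = fun t => \sum_i (#|[pred v | f t v == i]|%:R / t%:R)).
  apply: cvg_big => [|i _]; first exact: add_continuous.
  exact: part_ratio_cvg.
apply/funext => t; rewrite -mulr_suml -natr_sum.
by rewrite (sum_card_fibres (f t)).
Qed.

(** Since [N t] is asymptotic to [t], uniform weights on the blow-up push forward to part ratios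
    tending to [y]; [lambda_dens] transfers the limit to [lambda]. *)
Lemma lambda_pull_cvg n (G : graph n) (y : 'I_n -> R) (N : nat -> nat)
    (f : forall t, 'I_(N t) -> 'I_n) : simplex y -> part_sizes y f ->
  lambda gamma (pull G (f t)) @[t --> \oo] --> dens G y.
Proof.
move=> ys pf; have Nt := order_ratio_cvg ys pf.
have Ntpos : \forall t \near \oo, 0 < t%:R :> R /\ 0 < (N t)%:R :> R.
  near=> t; have t0 : 0 < t%:R :> R by rewrite ltr0n; near: t; exact: nbhs_infty_gt.
  split=> //; rewrite -(@pmulr_lgt0 _ (t%:R^-1)) ?invr_gt0//.
  by near: t; apply: (cvgr_gt _ Nt).
have ratio (u : nat -> R) (l : R) : u t / t%:R @[t --> \oo] --> l ->
    u t / (N t)%:R @[t --> \oo] --> l.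
  move=> ul.
  have H : u t / t%:R * ((N t)%:R / t%:R)^-1 @[t --> \oo] --> l * 1^-1.
    by apply: cvgM => //; apply: cvgV.
  rewrite invr1 mulr1 in H; apply: (near_cvg H); near=> t.
  have [t0 N0] : 0 < t%:R :> R /\ 0 < (N t)%:R :> R by near: t.
  by rewrite /=; field; rewrite !gt_eqF.
have D : dens (pull G (f t)) (fun=> (N t)%:R^-1) @[t --> \oo] --> dens G y.
  under eq_fun do rewrite dens_pull; apply: dens_cvg => v.
  have H := ratio _ _ (@part_ratio_cvg n y N f v pf).
  apply: (near_cvg H).
  by near=> t; rewrite /push sumr_const mulr_natl.
have E : 2 * gsum * (k ^ 2)%:R * (N t)%:R^-1 @[t --> \oo] --> (0 : R).
  apply: ratio; rewrite -[X in _ --> X](mulr0 (2 * gsum * (k ^ 2)%:R)).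
  by apply: cvgMl_tmp; exact: invn_cvg0.
rewrite -[X in _ --> X]addr0.
have : lambda gamma (pull G (f t)) - dens (pull G (f t)) (fun=> (N t)%:R^-1)
    @[t --> \oo] --> (0 : R).
  apply/cvgr0Pnorm_le => e e0; near=> t.
  apply: (@le_trans _ _ (2 * gsum * (k ^ 2)%:R * (N t)%:R^-1)).
    apply: lambda_dens; rewrite -(ltr0n R).
    by have [t0 N0] : 0 < t%:R :> R /\ 0 < (N t)%:R :> R by near: t.
  by near: t; apply: (cvgr_le _ E).
move=> E0; have H : dens (pull G (f t)) (fun=> (N t)%:R^-1) +
    (lambda gamma (pull G (f t)) - dens (pull G (f t)) (fun=> (N t)%:R^-1))
    @[t --> \oo] --> dens G y + 0 by apply: cvgD.
apply: (near_cvg H); near=> t.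
by rewrite /= addrC subrK.
Unshelve. all: by end_near. Qed.

End WeightedDensity.

(** * Blow-ups with prescribed part ratios *)

Lemma card_tag (I : finType) (a : I -> nat) (i : I) :
  #|[pred p : {i : I & 'I_(a i)} | tag p == i]| = a i.
Proof.
rewrite -sum1_card (eq_bigl (fun p => (tag p == i) && true)); last first.
  by move=> p; rewrite inE andbT.
rewrite -(@sig_big_dep _ _ _ _ _ (pred1 i) (fun _ _ => true) (fun _ _ => 1%N)).
by rewrite big_pred1_eq sum1_card card_ord.
Qed.

(** Part sizes are rounded up, which guarantees enough clones of each vertex in [robust_dens]. *)
Lemma parts_exist (R : realType) n (y : 'I_n -> R) : (forall i, 0 <= y i) ->
  exists (N : nat -> nat) (f : forall t, 'I_(N t) -> 'I_n),
    part_sizes y f /\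
    forall t i, y i * t%:R <= #|[pred v | f t v == i]|%:R.
Proof.
move=> y0; pose a t i := (Num.truncn (y i * t%:R)).+1.
pose T t : finType := {i : 'I_n & 'I_(a t i)}.
pose f t (v : 'I_#|T t|) := tag (enum_val v).
have cf t i : #|[pred v | f t v == i]| = a t i.
  rewrite -(card_tag (a t) i) -[LHS]sum1_card -[RHS]sum1_card.
  by rewrite [RHS](reindex _ (onW_bij _ (enum_val_bij (T t)))).
exists (fun t => #|T t|), f; split=> [|t i]; last first.
  by rewrite cf; have /truncn_itv/andP[_ /ltW] : 0 <= y i * t%:R by rewrite mulr_ge0.
exists 1 => t i; rewrite cf.
have /truncn_itv/andP[h1 h2] : 0 <= y i * t%:R by rewrite mulr_ge0.
rewrite ger0_norm; last by rewrite subr_ge0 ltW.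
rewrite /a -[X in X - _]natr1; lra.
Qed.

Section BlowupDensity.
Variables (R : realType) (F : graph_class) (k : nat) (gamma : G0 F k -> R).

(** [parts_exist] supplies a sequence of blow-ups, without which every number would vacuously be a
    limit; along it the limit is unique. *)
Lemma lambda_atE m (B : graph m) (y : 'I_m -> R) : simplex y ->
  lambda_at gamma B y = dens gamma B y.
Proof.
move=> ys; have [N [f [pf _]]] := parts_exist (proj1 ys).
apply: xget_unique => [N' f' pf'|l /(_ N f pf)]; first exact: lambda_pull_cvg.
move=> h; rewrite -(cvg_lim (@Rhausdorff R) h).
by apply: (cvg_lim (@Rhausdorff R)); apply: lambda_pull_cvg.
Qed.

Lemma lambda_blowups_ge m (B : graph m) (y : 'I_m -> R) : simplex y ->
  ((dens gamma B y)%:E <= lambda_blowups gamma B)%E.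
Proof. by move=> ys; apply: ereal_sup_ubound; exists y => //; rewrite lambda_atE. Qed.

(** If [y i] vanished, the other weights would reach the same density on [B] without [i], against
    minimality. *)
Lemma lambda_minimal_pos m (B : graph m) (y : 'I_m -> R) :
  lambda_minimal gamma B -> simplex y ->
  (dens gamma B y)%:E = lambda_blowups gamma B -> forall i, 0 < y i.
Proof.
move=> Bm [y0 y1] yB i; rewrite lt_neqAle y0 andbT; apply/eqP => yi0.
have := Bm i; rewrite ltNge => /negP; apply.
have yE : push (lift i) (fun j => y (lift i j)) =1 y.
  move=> j; rewrite /push; case: (unliftP i j) => [j' ->|->].
    by rewrite (eq_bigl (pred1 j')) ?big_pred1_eq// => v; rewrite (inj_eq lift_inj).
  by rewrite big1 -?yi0// => v; rewrite eq_sym (negbTE (neq_lift _ _)).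
rewrite -yB -(eq_dens gamma B yE) -dens_pull; apply: lambda_blowups_ge; split=> //.
by rewrite -y1 [RHS](bigD1_ord i)//= -yi0 add0r.
Qed.

End BlowupDensity.

(** * Compactness of the set of maximisers *)

Section Maximizers.
Variables (R : realType) (F : graph_class) (k : nat) (gamma : G0 F k -> R).
Variables (m : nat) (B : graph m) (ls : R).
Hypothesis m_gt0 : (0 < m)%N.
Hypothesis lsE : ls%:E = lambda_blowups gamma B.
Hypothesis Bmin : lambda_minimal gamma B.

Let K := [set v : 'rV[R]_m | simplex (v ord0)].
Let D (v : 'rV[R]_m) := dens gamma B (v ord0).

Let D_cont : continuous D.
Proof. by move=> v; apply: (dens_cvg (Fl := nbhs v)) => i; apply: coord_continuous. Qed.

Let closed_K : closed K.
Proof.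
have -> : K = \bigcap_(i in [set: 'I_m])
        ((fun v : 'rV[R]_m => v ord0 i) @^-1` [set x | 0 <= x])
    `&` (fun v : 'rV[R]_m => \sum_i v ord0 i) @^-1` [set x | x = 1].
  apply/seteqP; split=> v /= [h1 h2]; split=> // i; last exact: (h1 i I).
  by move=> _; apply: h1.
apply: closedI; first apply: closed_bigI => i _.
  by apply: closed_comp => [v _|]; [exact: coord_continuous|exact: closed_ge].
apply: closed_comp => [v _|]; last exact: closed_eq.
apply: (@cvg_big _ _ _ _ _ _ _ (nbhs v)) => [|i _].
  exact: add_continuous.
exact: coord_continuous.
Qed.

Let compact_K : compact K.
Proof.
have cC : compact [set v : 'rV[R]_m | forall i, `[0, 1]%classic (v ord0 i)].
  by apply: (@rV_compact R m (fun=> `[0, 1]%classic)) => i; apply: segment_compact.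
apply: (subclosed_compact closed_K cC).
move=> v [v0 v1] i /=; rewrite in_itv /= v0 /= -v1.
by rewrite [leRHS](bigD1 i)//= lerDl sumr_ge0.
Qed.

Lemma dens_le y : simplex y -> dens gamma B y <= ls.
Proof. by move=> ys; rewrite -lee_fin lsE lambda_blowups_ge. Qed.

Let of_fun (y : 'I_m -> R) : 'rV[R]_m := \row_i y i.

Let of_funE y : (of_fun y) ord0 =1 y.
Proof. by move=> i; rewrite mxE. Qed.

Let of_fun_K y : simplex y -> K (of_fun y).
Proof.
move=> [y0 y1]; split=> [i|]; first by rewrite of_funE.
by rewrite -y1; apply: eq_bigr => i _; rewrite of_funE.
Qed.

Let M := K `&` D @^-1` [set x | x = ls].

Let closed_M : closed M.
Proof.
apply: closedI => //; apply: closed_comp => [v _|]; [exact: D_cont|exact: closed_eq].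
Qed.

Let compact_M : compact M.
Proof. by apply: subclosed_compact closed_M compact_K _ => v []. Qed.

Let M_neq0 : M !=set0.
Proof.
have K0 : K !=set0.
  exists (of_fun (fun i => (i == Ordinal m_gt0)%:R)); apply: of_fun_K; split=> //.
  by rewrite (bigD1 (Ordinal m_gt0))//= big1 ?addr0// => i /negbTE ->.
have [c cK cmax] := EVT_max_rV K0 compact_K (continuous_subspaceT D_cont).
rewrite inE in cK; exists c; split=> //=; apply/eqP; rewrite eq_le dens_le//=.
rewrite -lee_fin lsE; apply: ub_ereal_sup => _ [y ys <-].
rewrite lambda_atE// lee_fin -(eq_dens gamma B (of_funE y)).
by apply: cmax; rewrite inE; apply: of_fun_K.
Qed.

(** Each coordinate attains its minimum on the compact set of maximisers, and this minimum is
    positive by [lambda_minimal_pos]. *)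
Lemma maximizer_lb : exists2 b : R, 0 < b &
  forall y, simplex y -> dens gamma B y = ls -> forall i, b <= y i.
Proof.
have /fin_all_exists[b hb] (i : 'I_m) : exists b : R, 0 < b /\ forall v, M v -> b <= v ord0 i.
  have [c + cmin] := EVT_min_rV M_neq0 compact_M
    (continuous_subspaceT (@coord_continuous R 1 m ord0 i)).
  rewrite inE => -[cK cM]; exists (c ord0 i); split=> [|v vM].
    by apply: (lambda_minimal_pos Bmin cK); rewrite -lsE -cM.
  by apply: cmin; rewrite inE.
exists (\big[Num.min/1]_i b i).
  by apply: lt_bigmin => // i _; have [] := hb i.
move=> y ys yD i; have [_ /(_ (of_fun y))] := hb i; rewrite of_funE => h.
apply: le_trans (bigmin_le _ _ _) (h _); split; first exact: of_fun_K.
by rewrite /D /= (eq_dens gamma B (of_funE y)).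
Qed.

(** The points of the simplex far from all maximisers form a compact set, on which the largest
    density is below [ls]; half of this gap serves as [e]. *)
Lemma near_maximizer (eta : R) : 0 < eta -> exists2 e : R, 0 < e &
  forall y, simplex y -> ls - e <= dens gamma B y ->
  exists x, [/\ simplex x, dens gamma B x = ls & forall i, `|y i - x i| <= eta].
Proof.
move=> eta0; pose A := K `&` ~` (\bigcup_(x in M) ball x eta).
have near_of y : simplex y -> ~ A (of_fun y) ->
    exists x, [/\ simplex x, dens gamma B x = ls & forall i, `|y i - x i| <= eta].
  move=> ys nA; have [x [xK xM] xy] : (\bigcup_(x in M) ball x eta) (of_fun y).
    by apply: contrapT => h; apply: nA; split=> //; apply: of_fun_K.
  exists (x ord0); split=> // i.
  by have := xy.2 ord0 i; rewrite /ball /= of_funE distrC => /ltW.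
have [A0|/set0P A0] := eqVneq A set0.
  by exists 1 => // y ys _; apply: near_of => //; rewrite A0.
have cA : compact A.
  apply: subclosed_compact compact_K _; last by move=> v [].
  apply: closedI => //; apply: open_closedC; apply: bigcup_open => x _.
  exact: ball_open.
have [c + cmax] := EVT_max_rV A0 cA (continuous_subspaceT D_cont).
rewrite inE => -[cK cN].
have Dc : D c < ls.
  rewrite lt_neqAle dens_le// andbT; apply/eqP => e; apply: cN; exists c => //.
  exact: ballxx.
exists ((ls - D c) / 2); first by rewrite divr_gt0// subr_gt0.
move=> y ys h; apply: near_of => // yA.
have := cmax (of_fun y); rewrite inE => /(_ yA).
rewrite /D (eq_dens gamma B (of_funE y)) -/(D c); lra.
Qed.

End Maximizers.

(** * Wrong pairs under blow-up, and the edit distance *)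

Lemma card_pred_pair (A B : finType) (P : A -> pred B) :
  #|[pred z : A * B | P z.1 z.2]| = (\sum_a #|P a|)%N.
Proof.
rewrite -sum1_card (eq_bigr (fun a => \sum_(b | P a b) 1)%N); last first.
  by move=> a _; rewrite sum1_card.
by rewrite pair_big_dep /=; apply: eq_bigl => z; rewrite inE.
Qed.

(* Choosing one of [a] clones of each vertex independently turns a recolouring
   of the blow-up into one of [G]; averaging over all [a ^ n] choices, each
   wrong pair survives with probability [a ^ -2]. *)
Lemma nwrong_pull_ge n N m (G : graph n) (B : graph m) (g : 'I_N -> 'I_n)
    (h : 'I_N -> 'I_m) (a w : nat) :
  (forall v, a <= #|[pred x | g x == v]|)%N ->
  (forall h' : 'I_n -> 'I_m, w <= nwrong G (pull B h'))%N ->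
  (w * a ^ 2 <= nwrong (pull G g) (pull B h))%N.
Proof.
move=> ga hw; have [->|a0] := posnP a; first by rewrite muln0.
have /fin_all_exists[s hs] (v : 'I_n) : exists s : 'I_a -> 'I_N,
    injective s /\ forall p, g (s p) = v.
  exists (fun p => enum_val (widen_ord (ga v) p)); split.
    by move=> p q /enum_val_inj/(congr1 val)/= /val_inj.
  by move=> p; have := enum_valP (widen_ord (ga v) p); rewrite inE => /eqP.
pose W := wrong (pull G g) (pull B h).
have W_irr x : W x x = false by apply: wrong_irr.
pose X (u : 'I_n * 'I_n) (e : {ffun 'I_n -> 'I_a}) :=
  W (s u.1 (e u.1)) (s u.2 (e u.2)).
have h1 : (w * a ^ n <= \sum_u #|X u|)%N.
  have -> : (\sum_u #|X u| = \sum_(e : {ffun 'I_n -> 'I_a}) #|[pred u | X u e]|)%N.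
    under eq_bigr do rewrite -sum1_card big_mkcond /=.
    rewrite exchange_big; apply: eq_bigr => e _.
    by rewrite -sum1_card [RHS]big_mkcond; apply: eq_bigr => u _; rewrite inE.
  have -> : (a ^ n = #|{: {ffun 'I_n -> 'I_a}}|)%N by rewrite card_ffun !card_ord.
  rewrite mulnC -sum_nat_const; apply: leq_sum => e _.
  apply: (leq_trans (hw (fun v => h (s v (e v))))).
  apply: subset_leq_card; apply/fintype.subsetP => -[u v]; rewrite !inE /=.
  by rewrite /X /W /wrong !adj_pull (hs u).2 (hs v).2.
have h2 : ((\sum_u #|X u|) * a ^ 2 <= nwrong (pull G g) (pull B h) * a ^ n)%N.
  pose Y (u : 'I_n * 'I_n) (p : 'I_a * 'I_a) := W (s u.1 p.1) (s u.2 p.2).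
  apply: (@leq_trans ((\sum_u #|Y u|) * a ^ n)%N).
    rewrite !big_distrl /=; apply: leq_sum => -[u v] _.
    have [<-|uv] := eqVneq u v.
      rewrite eq_card0// => e; apply: W_irr.
    have := @card_pair_le 'I_n 'I_a u v (Y (u, v)) uv.
    by rewrite !card_ord.
  rewrite leq_mul2r; apply/orP; right; rewrite -card_pred_pair.
  (* As [g] recovers a vertex from its clone, each wrong pair of the blow-up is counted at most
     once. *)
  pose sg (z : ('I_n * 'I_n) * ('I_a * 'I_a)) := (s z.1.1 z.2.1, s z.1.2 z.2.2).
  apply: (@leq_card_pred _ _ _ _ sg) => [z z'|[[u v] [p q]] //].
  case: z z' => [[u v] [p q]] [[u' v'] [p' q']] _ _ [e1 e2].
  have eu : u = u' by rewrite -((hs u).2 p) -((hs u').2 p') e1.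
  have ev : v = v' by rewrite -((hs v).2 q) -((hs v').2 q') e2.
  by subst u' v'; rewrite ((hs u).1 _ _ e1) ((hs v).1 _ _ e2).
have an0 : (0 < a ^ n)%N by rewrite expn_gt0 a0.
rewrite -(leq_pmul2r an0) mulnAC; apply: leq_trans h2.
by rewrite leq_mul2r h1 orbT.
Qed.

Lemma nwrong_min n m (G : graph n) (B : graph m) : (0 < m)%N ->
  exists f0 : 'I_n -> 'I_m, forall f : 'I_n -> 'I_m,
    (nwrong G (pull B f0) <= nwrong G (pull B f))%N.
Proof.
move=> m0; have := @arg_minnP {ffun 'I_n -> 'I_m} [ffun=> Ordinal m0] predT
  (fun f => nwrong G (pull B f)) isT.
case=> f0 _ hf; exists f0 => f; have := hf [ffun x => f x] isT.
by rewrite (eq_pull B (_ : [ffun x => f x] =1 f))// => x; rewrite ffunE.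
Qed.

Section EditDistance.
Variable R : realType.

Lemma edit_dist_le n m (G : graph n) (B : graph m) (f : 'I_n -> 'I_m) :
  edit_dist R B G <= (nwrong G (pull B f))%:R / 2 / 'C(n, 2)%:R.
Proof.
rewrite ler_wpM2r ?invr_ge0// nwrongE -muln2 natrM mulfK ?pnatr_eq0//.
apply: ge_inf; first by exists 0 => _ [H _ <-].
by exists (pull B f) => //; exists f.
Qed.

(** Positivity of [m] makes the set of blow-ups nonempty, so that [inf] is not a default value; the
    division by 2 passes from ordered to unordered pairs. *)
Lemma edit_dist_ge n m (G : graph n) (B : graph m) (c : R) : (0 < m)%N ->
  (forall f : 'I_n -> 'I_m, c <= (nwrong G (pull B f))%:R) ->
  c / 2 / 'C(n, 2)%:R <= edit_dist R B G.
Proof.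
move=> m0 hc; rewrite ler_wpM2r ?invr_ge0//; apply: lb_le_inf.
  pose H := pull B (fun=> Ordinal m0 : 'I_m) : graph n.
  by exists (changes G H)%:R, H => //; eexists.
move=> _ [_ [f ->] <-]; rewrite ler_pdivrMr ?ltr0n//.
by have := hc f; rewrite nwrongE -muln2 natrM.
Qed.

Lemma bin2_le n : 'C(n, 2)%:R * 2 <= n%:R ^+ 2 :> R.
Proof.
rewrite -natrM -natrX ler_nat bin2 muln2 expnS expn1.
case: n => // n /=; rewrite -[leqRHS]odd_double_half.
apply: (@leq_trans ((n.+1 * n.+1)./2).*2); last exact: leq_addl.
by rewrite leq_double half_leq// leq_mul2l leqnSn orbT.
Qed.

End EditDistance.

(** * Robust stability along growing blow-ups *)

Section RobustLimit.
Variables (R : realType) (F : graph_class) (k : nat) (gamma : G0 F k -> R).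
Hypothesis Ftf : forall n (H : graph n), @F n H -> twin_free H.
Variables (m : nat) (B : graph m).
Hypothesis m_gt0 : (0 < m)%N.
Hypothesis B_adm : forall n, @blowups m B n `<=` Forb F n.
Variable C : R.
Hypothesis C_gt0 : 0 < C.
Hypothesis B_rob : forall n (G : graph n), Forb F n G -> C <= n%:R ->
  edit_dist R B G <= C * Num.max n%:R^-1 (lambda_max gamma n - lambda gamma G).

Lemma Forb_inhabited n : exists G : graph n, Forb F n G.
Proof.
exists (pull B (fun=> Ordinal m_gt0)); apply: B_adm.
by exists (fun=> Ordinal m_gt0).
Qed.

(* The [1/n] term of robust stability disappears when it is applied to ever
   larger blow-ups of [G]. *)
Lemma robust_dens n (G : graph n) (y : 'I_n -> R) (b : R) (w : nat) :
  Forb F n G -> simplex y -> 0 < b -> (forall v, b <= y v) ->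
  (forall f : 'I_n -> 'I_m, w <= nwrong G (pull B f))%N ->
  w%:R * b ^+ 2 <= C * (lambda_lim gamma - dens gamma G y).
Proof.
move=> FG ys b0 yb hw.
have [N [f [pf fy]]] := parts_exist (proj1 ys).
have tN t : t%:R <= (N t)%:R :> R.
  have -> : t%:R = \sum_i y i * t%:R by rewrite -mulr_suml (proj2 ys) mul1r.
  rewrite -[X in _ <= X%:R](sum_card_fibres (f t)) natr_sum.
  by apply: ler_sum => i _; apply: fy.
have Noo : N t @[t --> \oo] --> \oo.
  apply/cvgnyPge => A; exists A => // t /= At.
  by apply: leq_trans At _; rewrite -(ler_nat R).
have lN : lambda_max gamma (N t) @[t --> \oo] --> lambda_lim gamma.
  exact: (cvg_comp _ _ Noo (@lambda_max_cvg R F k gamma Ftf Forb_inhabited)).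
have Gt := @lambda_pull_cvg R F k gamma n G y N f ys pf.
have Nt := order_ratio_cvg ys pf.
have iN : (N t)%:R^-1 @[t --> \oo] --> (0 : R).
  exact: (cvg_comp _ _ Noo (@invn_cvg0 R)).
(* The term [b - t%:R^-1] allows for rounding the number [b * t%:R] of clones down to an integer. *)
have lhs : w%:R * (b - t%:R^-1) ^+ 2 * ((N t)%:R / t%:R)^-1 ^+ 2 @[t --> \oo]
    --> w%:R * (b - 0) ^+ 2 * 1^-1 ^+ 2.
  apply: cvgM; last by apply: cvgM; apply: cvgV => //; apply: oner_neq0.
  apply: cvgMl_tmp; apply: cvgM;
    by apply: cvgB; [exact: cvg_cst|exact: invn_cvg0].
have rhs : C * ((N t)%:R^-1 + (lambda_max gamma (N t) - lambda gamma (pull G (f t))))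
    @[t --> \oo] --> C * (0 + (lambda_lim gamma - dens gamma G y)).
  by apply: cvgMl_tmp; apply: cvgD => //; apply: cvgB.
rewrite add0r in rhs; rewrite subr0 invr1 expr1n mulr1 in lhs.
apply: (ler_cvg_to lhs rhs); near=> t.
have t0 : 0 < t%:R :> R by rewrite ltr0n; near: t; exact: nbhs_infty_gt.
have bt : t%:R^-1 <= b by near: t; apply: (cvgr_le _ (@invn_cvg0 R)).
have t2 : (1 < t)%N by near: t; exact: nbhs_infty_gt.
have CN : C <= (N t)%:R.
  apply: (@le_trans _ _ t%:R); last exact: tN.
  by near: t; apply: nbhs_infty_ger.
have FGt : Forb F (N t) (pull G (f t)) by apply: Forb_pull.
(* Robust stability bounds the edit distance above, with the maximum relaxed to a sum; counting
   wrong pairs among clones bounds it below. *)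
apply: le_trans (_ : edit_dist R B (pull G (f t)) <= _); last first.
  apply: le_trans (B_rob FGt CN) _; rewrite ler_pM2l// ge_max.
  by rewrite lerDl lerDr subr_ge0 lambda_max_ge//= invr_ge0 ler0n.
pose a := Num.truncn (b * t%:R).
have bt0 : 0 <= b * t%:R by rewrite mulr_ge0 ?ltW.
have /andP[a1 a2] := truncn_itv bt0; rewrite -/a in a1 a2.
have hf h : (w * a ^ 2)%:R <= (nwrong (pull G (f t)) (pull B h))%:R :> R.
  rewrite ler_nat; apply: nwrong_pull_ge => // v.
  rewrite -(ler_nat R) (le_trans a1)// (le_trans _ (fy t v))//.
  by rewrite ler_pM2r.
apply: le_trans (edit_dist_ge m_gt0 hf).
have N0 : 0 < (N t)%:R :> R by apply: lt_le_trans t0 _.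
have C2 : 0 < 'C(N t, 2)%:R :> R by rewrite ltr0n bin_gt0 (leq_trans t2)// -(ler_nat R).
have -> : (w * a ^ 2)%:R / 2 / 'C(N t, 2)%:R = w%:R * a%:R ^+ 2 / ('C(N t, 2)%:R * 2) :> R.
  by rewrite natrM natrX; field; rewrite gt_eqF.
apply: (@le_trans _ _ (w%:R * a%:R ^+ 2 / (N t)%:R ^+ 2)); last first.
  rewrite ler_wpM2l ?mulr_ge0 ?exprn_ge0// lef_pV2 ?posrE ?exprn_gt0 ?mulr_gt0//.
  exact: bin2_le.
have -> : w%:R * (b - t%:R^-1) ^+ 2 * ((N t)%:R / t%:R)^-1 ^+ 2
    = w%:R * ((b - t%:R^-1) * t%:R) ^+ 2 / (N t)%:R ^+ 2.
  by field; rewrite !gt_eqF.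
have q0 : 0 <= (b - t%:R^-1) * t%:R by rewrite mulr_ge0 ?subr_ge0// ltW.
rewrite ler_wpM2r ?invr_ge0 ?exprn_ge0// ler_wpM2l ?ler0n//.
rewrite ler_pXn2r ?nnegrE ?ler0n//.
by rewrite mulrBl mulVf ?gt_eqF// lerBlDr natr1 ltW.
Unshelve. all: by end_near. Qed.

End RobustLimit.

(** * Passing between nearly uniform weights and uniform distinct samples *)

Lemma prod_near1 (R : realFieldType) k (h : R) : 0 < h -> exists2 e : R, 0 < e &
  forall a : 'I_k -> R, (forall i, `|a i - 1| <= e) -> `|\prod_i a i - 1| <= h.
Proof.
elim: k h => [|k IH] h h0.
  by exists 1 => // a _; rewrite big_ord0 subrr normr0 ltW.
have h'0 : 0 < Num.min 1 (h / 2) by rewrite lt_min ltr01 divr_gt0.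
have [e e0 he] := IH _ h'0.
exists (Num.min e (h / 4)); first by rewrite lt_min e0 divr_gt0.
move=> a ha; rewrite big_ord_recr /=; set P := \prod_(i < k) _.
have /he : forall i : 'I_k, `|a (widen_ord (leqnSn k) i) - 1| <= e.
  by move=> i; have := ha (widen_ord (leqnSn k) i); rewrite le_min => /andP[].
rewrite -/P le_min => /andP[P1 P2].
have := ha ord_max; rewrite le_min => /andP[_ a4].
(* The three terms are at most [h / 4], [h / 4] and [h / 2]; the first uses that [P] is within 1 of
   1. *)
have -> : P * a ord_max - 1 = (P - 1) * (a ord_max - 1) + (a ord_max - 1) + (P - 1) by ring.
have := ler_pM (normr_ge0 _) (normr_ge0 _) P1 a4; rewrite -normrM mul1r => h3.
apply: le_trans (ler_normD _ _) _; apply: le_trans (lerD (ler_normD _ _) (lexx _)) _.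
lra.
Qed.

Lemma bin2_ge (R : realType) n : (1 < n)%N -> n%:R ^+ 2 <= 4 * 'C(n, 2)%:R :> R.
Proof.
move=> n2; rewrite -natrX -natrM ler_nat bin2.
have : (n * n.-1)./2.*2 = (n * n.-1)%N.
  by rewrite -[RHS]odd_double_half oddM; case: n n2 => //= n _; rewrite andNb.
rewrite -muln2 => e; rewrite (_ : 4 = 2 * 2)%N// mulnAC -mulnA e.
case: n n2 {e} => // n n1; rewrite expnS expn1 mulnCA leq_mul2l /=; lia.
Qed.

Section Gap.
Variables (R : realType) (F : graph_class) (k : nat) (gamma : G0 F k -> R).

(* Tuples with a repeated vertex or a reweighted product contribute only to
   lower order, because they matter only when they meet a wrong pair. *)
Lemma lambda_gap n (G G' : graph n) (y : 'I_n -> R) (h : R) : (0 < n)%N ->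
  (forall f : {ffun 'I_k -> 'I_n}, `|\prod_i (n%:R * y (f i)) - 1| <= h) ->
  n%:R ^+ k * (dens gamma G' y - dens gamma G y)
    - 2 * gsum gamma * ((k ^ 2)%:R * h + (k ^ 4)%:R / n%:R)
        * ((nwrong G G')%:R / n%:R ^+ 2 * n%:R ^+ k)
  <= (n ^_ k)%:R * (lambda gamma G' - lambda gamma G).
Proof.
move=> n0 hy; have M0 := gsum_ge0 gamma.
pose D (f : {ffun 'I_k -> 'I_n}) := Lambda gamma (pull G' f) - Lambda gamma (pull G f).
pose z (f : {ffun 'I_k -> 'I_n}) := \prod_i (n%:R * y (f i)).
pose b (f : {ffun 'I_k -> 'I_n}) : R := (bad (wrong G G') f)%:R.
have Db (f : {ffun 'I_k -> 'I_n}) : `|D f| <= 2 * gsum gamma * b f.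
  by rewrite distrC; apply: Lambda_diff_le.
have -> : n%:R ^+ k * (dens gamma G' y - dens gamma G y)
    = \sum_(f : {ffun 'I_k -> 'I_n}) z f * D f.
  rewrite -sumrB mulr_sumr; apply: eq_bigr => f _.
  by rewrite -mulrBr mulrA /z big_split /= prodr_const card_ord.
rewrite mulrBr !lambda_sum_inj -sumrB lerBlDr -lerBlDl.
(* Both remaining sums contain the factor [D f], which vanishes unless [f] meets a wrong pair. *)
have -> : \sum_f z f * D f - \sum_(f : {ffun 'I_k -> 'I_n} | injectiveb f) D f
    = \sum_f (z f - 1) * D f + \sum_(f : {ffun 'I_k -> 'I_n} | ~~ injectiveb f) D f.
  have -> : \sum_f (z f - 1) * D f = \sum_f z f * D f - \sum_f D f.
    by rewrite -sumrB; apply: eq_bigr => f _; rewrite mulrBl mul1r.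
  by rewrite [\sum_f D f](bigID (fun f : {ffun 'I_k -> 'I_n} => injectiveb f))/=; ring.
apply: (@le_trans _ _ (\sum_f h * (2 * gsum gamma * b f)
    + \sum_(f : {ffun 'I_k -> 'I_n} | ~~ injectiveb f) 2 * gsum gamma * b f)).
  apply: lerD; apply: ler_sum => f _; apply: le_trans (ler_norm _) _ => //.
  by rewrite normrM ler_pM//; apply: hy.
rewrite -!mulr_sumr.
have -> : \sum_f b f = #|[pred f : {ffun 'I_k -> 'I_n} | bad (wrong G G') f]|%:R.
  by rewrite -natr_sum -big_mkcond/= sum1_card.
have -> : \sum_(f : {ffun 'I_k -> 'I_n} | ~~ injectiveb f) b f
    = #|[pred f : {ffun 'I_k -> 'I_n} | bad (wrong G G') f && ~~ injectiveb f]|%:R.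
  rewrite -natr_sum -sum1_card [in RHS]big_mkcond [in LHS]big_mkcond /=.
  by congr (_%:R); apply: eq_bigr => f _; rewrite inE; do 2 case: ifP; case: (bad _ _).
have hc1 := @card_badR R k n G G' n0.
have hc2 := @card_bad_noninjR R k n G G' n0.
have h0 : 0 <= h := le_trans (normr_ge0 _) (hy [ffun=> Ordinal n0]).
set Q := (nwrong G G')%:R / n%:R ^+ 2 * n%:R ^+ k in hc2 *.
have {}hc1 : #|[pred f : {ffun 'I_k -> 'I_n} | bad (wrong G G') f]|%:R <= (k ^ 2)%:R * Q.
  apply: le_trans hc1 _; rewrite /Q [leRHS]mulrA [X in _ <= X * _]mulrA.
  exact: lexx.
have -> : 2 * gsum gamma * ((k ^ 2)%:R * h + (k ^ 4)%:R / n%:R) * Q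
  = h * (2 * gsum gamma * ((k ^ 2)%:R * Q)) + 2 * gsum gamma * ((k ^ 4)%:R / n%:R * Q) by ring.
by apply: lerD; rewrite ?ler_wpM2l ?mulr_ge0.
Qed.

End Gap.

(** The weight [x i] is spread evenly over its part. The tolerance [b / 2] keeps every part
    proportion at least [b / 2], and [e * (b / 2)] then makes the relative error at most [e]. *)
Lemma reweight (R : realType) n m (f0 : 'I_n -> 'I_m) (x : 'I_m -> R) (b e : R) :
  (0 < n)%N -> 0 < b -> 0 < e -> simplex x -> (forall i, b <= x i) ->
  (forall i, `|push f0 (fun=> n%:R^-1) i - x i| <= Num.min (b / 2) (e * (b / 2))) ->
  exists y, [/\ simplex y, push f0 y =1 x, forall v, b / n%:R <= y v
    & forall v, `|n%:R * y v - 1| <= e].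
Proof.
move=> n0 b0 e0 [x0 x1] bx hx; have n0' : 0 < n%:R :> R by rewrite ltr0n.
pose V i := #|[pred v | f0 v == i]|.
have VE i : push f0 (fun=> n%:R^-1) i = (V i)%:R / n%:R.
  by rewrite /push sumr_const mulr_natl.
have Vb i : b / 2 <= (V i)%:R / n%:R.
  have := hx i; rewrite le_min => /andP[+ _]; rewrite VE ler_norml => /andP[+ _].
  by have := bx i; lra.
have V0 i : 0 < (V i)%:R :> R.
  rewrite -(pmulr_lgt0 _ (_ : 0 < n%:R^-1)) ?invr_gt0//.
  by apply: lt_le_trans (Vb i); rewrite divr_gt0.
exists (fun v => x (f0 v) / (V (f0 v))%:R).
have pE : push f0 (fun v => x (f0 v) / (V (f0 v))%:R) =1 x.
  move=> i; rewrite /push (eq_bigr (fun=> x i / (V i)%:R)) => [|v /eqP ->//].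
  by rewrite sumr_const -[LHS]mulr_natr; apply: (divfK (lt0r_neq0 (V0 i))).
split=> // [|v|v].
- split=> [v|]; first by rewrite divr_ge0.
  by rewrite -[RHS]x1 (partition_big f0 predT)//=; apply: eq_bigr => i _; apply: pE.
- apply: ler_pM => //; first exact: ltW.
  rewrite lef_pV2 ?posrE// ler_nat.
  by rewrite -[leqRHS]card_ord max_card.
have -> : n%:R * (x (f0 v) / (V (f0 v))%:R) - 1
    = (x (f0 v) - (V (f0 v))%:R / n%:R) / ((V (f0 v))%:R / n%:R).
  by field; rewrite !gt_eqF.
have Vn0 : 0 < (V (f0 v))%:R / n%:R :> R by rewrite divr_gt0.
rewrite normrM normfV (gtr0_norm Vn0) ler_pdivrMr// distrC -VE.
have := hx (f0 v); rewrite le_min => /andP[_ h]; apply: le_trans h _.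
by rewrite ler_pM2l// VE.
Qed.

(** * Perfect stability: choice of constants and conclusion *)

Unset Implicit Arguments.

Theorem theorem5p7 (R : realType) (k m : nat) (k_gt0 : (0 < k)%N)
  (m_gt0 : (0 < m)%N) (F : graph_class)
  (F_twin_free : forall n (H : graph n), F n H -> twin_free H)
  (gamma : G0 F k -> R) (B : graph m)
  (B_admissible : forall n, blowups B n `<=` Forb F n)
  (lambdaB : (lambda_lim gamma)%:E = lambda_blowups gamma B)
  (B_robust : robustly_stable gamma B)
  (B_minimal : lambda_minimal gamma B) :
  perfectly_stable gamma B.
Proof.
have [C C0 rob] := B_robust.
have Fne := Forb_inhabited m_gt0 B_admissible.
have [b b0 hb] := maximizer_lb m_gt0 lambdaB B_minimal.
set M := gsum gamma; have M0 : 0 <= M := gsum_ge0 gamma.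
set ls := lambda_lim gamma in lambdaB hb *.
pose K2 : R := (k ^ 2)%:R; pose K4 : R := (k ^ 4)%:R.
have K20 : 0 <= K2 by apply: ler0n.
have K40 : 0 <= K4 by apply: ler0n.
(* With least weight [b / n], [robust_dens] will give a gap of [c * q / n ^ 2] between the
   [y]-weighted densities. *)
pose c := b ^+ 2 / C; have c0 : 0 < c by rewrite divr_gt0// exprn_gt0.
(* Here [h] will bound the reweighting error and [s] will bound [1 / n], each costing at most
   [c / 4]; the added 1 avoids division by zero. *)
pose h := c / (8 * (M * K2 + 1)).
have d1 : 0 < 8 * (M * K2 + 1) by have := mulr_ge0 M0 K20; lra.
have h0 : 0 < h by rewrite divr_gt0.
have hE : 2 * M * (K2 * h) <= c / 4.
  have : h * (8 * (M * K2 + 1)) = c by rewrite /h divfK// gt_eqF.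
  by have := ltW h0; lra.
pose s := c / (8 * (M * K4 + 1)).
have d2 : 0 < 8 * (M * K4 + 1) by have := mulr_ge0 M0 K40; lra.
have s0 : 0 < s by rewrite divr_gt0.
have sE : 2 * M * (K4 * s) <= c / 4.
  have : s * (8 * (M * K4 + 1)) = c by rewrite /s divfK// gt_eqF.
  by have := ltW s0; lra.
have [e e0 he] := @prod_near1 R k h h0.
have eta0 : 0 < Num.min (b / 2) (e * (b / 2)).
  by rewrite lt_min !(divr_gt0, mulr_gt0).
have [ep ep0 hep] := near_maximizer lambdaB eta0.
(* Three losses lead from [ls] to the density of [B] at the part ratios: [tau] for the deficit, then
   [1 / n <= tau] in [lambda_dens] and [q / n ^ 2 <= C * tau] in [dens_diff]. *)
pose d3 := 1 + 2 * M * K2 * (1 + C).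
have d30 : 0 < d3.
  have := mulr_ge0 (mulr_ge0 M0 K20) (ltW C0); have := mulr_ge0 M0 K20.
  by rewrite /d3; lra.
pose tau := ep / d3; have tau0 : 0 < tau by rewrite divr_gt0.
(* [C] covers a large deficit, [4 / c] the final estimate; the other summands force [n] to be
   large. *)
pose C' := C + 4 / c + (k.+2)%:R + tau^-1 + s^-1.
have k20 : 0 < (k.+2)%:R :> R by rewrite ltr0n.
have [i1 i2 i3] : [/\ 0 < 4 / c, 0 < tau^-1 & 0 < s^-1].
  by rewrite !invr_gt0 divr_gt0.
exists C'; first by rewrite /C'; lra.
move=> n G FG C'n.
have Cn : C <= n%:R by apply: le_trans C'n; rewrite /C'; lra.
have kn : (k.+2 <= n)%N by rewrite -(ler_nat R); apply: le_trans C'n; rewrite /C'; lra.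
have tn : tau^-1 <= n%:R by apply: le_trans C'n; rewrite /C'; lra.
have sn : s^-1 <= n%:R by apply: le_trans C'n; rewrite /C'; lra.
have n0 : (0 < n)%N by apply: leq_trans kn.
have n0' : 0 < n%:R :> R by rewrite ltr0n.
have {}tn : n%:R^-1 <= tau by rewrite -[tau]invrK lef_pV2 ?posrE.
have {}sn : n%:R^-1 <= s by rewrite -[s]invrK lef_pV2 ?posrE.
pose Dl := lambda_max gamma n - lambda gamma G; rewrite -/Dl.
have Dl0 : 0 <= Dl by rewrite subr_ge0 lambda_max_ge.
have CC' : C <= C' by rewrite /C'; lra.
have := rob n G FG Cn; rewrite -/Dl => robG.
(* A deficit of at least [tau >= 1 / n] is itself the maximum in the robust bound. *)
have [tD|Dt] := leP tau Dl.
  apply: le_trans robG _; rewrite max_r; last exact: le_trans tD.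
  by rewrite ler_wpM2r.
have [f0 f0min] := nwrong_min G B m_gt0.
set q := nwrong G (pull B f0) in f0min.
have n2 : (1 < n)%N by apply: leq_trans kn.
have C2 : 0 < 'C(n, 2)%:R :> R by rewrite ltr0n bin_gt0.
have qn0 : 0 <= q%:R / n%:R ^+ 2 :> R by rewrite divr_ge0 ?exprn_ge0.
have qC : q%:R / n%:R ^+ 2 <= C * tau.
  have hf f : q%:R <= (nwrong G (pull B f))%:R :> R by rewrite ler_nat.
  have hq := edit_dist_ge m_gt0 hf.
  apply: le_trans (_ : q%:R / 2 / 'C(n, 2)%:R <= _).
    rewrite -mulrA -invfM ler_wpM2l ?ler0n// lef_pV2 ?posrE ?exprn_gt0 ?mulr_gt0//.
    by rewrite mulrC bin2_le.
  apply: le_trans hq _; apply: le_trans robG _.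
  by rewrite ler_pM2l// ge_max tn; apply: ltW.
pose r := push f0 (fun=> n%:R^-1 : R).
have rs : simplex r.
  split=> [i|]; first by apply: sumr_ge0 => v _; rewrite invr_ge0.
  have <- : \sum_(v < n) n%:R^-1 = \sum_i r i by rewrite (partition_big f0 predT).
  by rewrite sumr_const card_ord -[LHS]mulr_natr mulVf// gt_eqF.
have lmax : ls <= lambda_max gamma n.
  apply: lambda_lim_le => //; apply: leq_trans kn; exact: leqW.
have rB : ls - ep <= dens gamma B r.
  rewrite -dens_pull.
  have := dens_diff gamma G (pull B f0) n0; rewrite -/M -/q -/K2 ler_norml => /andP[_ a1].
  have := lambda_dens gamma G n0; rewrite -/M -/K2 ler_norml => /andP[_ a2].
  have MK : 0 <= 2 * M * K2 by rewrite !mulr_ge0.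
  have a3 := ler_wpM2l MK qC; have a4 := ler_wpM2l MK tn.
  have a5 : tau * d3 = ep by rewrite /tau divfK// gt_eqF.
  rewrite /d3 in a5; move: Dt lmax a1 a2 a3 a4 a5; rewrite /Dl; lra.
have [x [xs xB rx]] := hep r rs rB.
(* Under [y] the closest blow-up has part weights exactly [x], hence density [ls]. *)
have [y [ys yp yb yn]] := reweight n0 b0 e0 xs (hb x xs xB) rx.
have bn0 : 0 < b / n%:R by rewrite divr_gt0.
have gap1 : c * (q%:R / n%:R ^+ 2) <= dens gamma (pull B f0) y - dens gamma G y.
  have := robust_dens F_twin_free m_gt0 B_admissible C0 rob FG ys bn0 yb f0min.
  rewrite dens_pull (eq_dens gamma B yp) xB -/ls => a1.
  rewrite -(ler_pM2l C0); apply: le_trans a1.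
  rewrite le_eqVlt; apply/orP; left; apply/eqP; rewrite /c.
  by field; rewrite !gt_eqF.
have hy f : `|\prod_(i < k) (n%:R * y (f i)) - 1| <= h by apply: he => i; apply: yn.
have := lambda_gap gamma G (pull B f0) n0 (fun f => hy f).
rewrite -/M -/K2 -/K4 -/q => gap2.
have nk0 : 0 < n%:R ^+ k :> R by rewrite exprn_gt0.
have nf0 : 0 < (n ^_ k)%:R :> R.
  by rewrite ltr0n ffact_gt0; apply: leq_trans kn; apply: leqW.
(* The two errors of [c / 4] leave half of the gap. *)
have X1 : n%:R ^+ k * (c / 2 * (q%:R / n%:R ^+ 2))
    <= (n ^_ k)%:R * (lambda gamma (pull B f0) - lambda gamma G).
  apply: le_trans gap2.
  have a1 := ler_wpM2l (ltW nk0) gap1.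
  have a2 : 2 * M * (K2 * h + K4 / n%:R) <= c / 2.
    have : 2 * M * (K4 / n%:R) <= 2 * M * (K4 * s) by rewrite !ler_wpM2l ?mulr_ge0.
    by move: hE sE; lra.
  have := ler_wpM2r (mulr_ge0 qn0 (ltW nk0)) a2.
  move: a1; set Q := q%:R / _; lra.
(* Nonnegativity permits replacing [n ^_ k] by the larger [n ^ k] on the right. *)
have X0 : 0 <= lambda gamma (pull B f0) - lambda gamma G.
  rewrite -(pmulr_rge0 _ nf0); apply: le_trans X1.
  apply: mulr_ge0 (ltW nk0) (mulr_ge0 _ qn0); lra.
have X2 : c / 2 * (q%:R / n%:R ^+ 2) <= lambda gamma (pull B f0) - lambda gamma G.
  rewrite -(ler_pM2l nk0); apply: le_trans X1 _; apply: ler_wpM2r => //.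
  have := max_card [pred f : {ffun 'I_k -> 'I_n} | injectiveb f].
  by rewrite card_injffun card_ffun !card_ord -natrX ler_nat.
have X3 : c / 2 * (q%:R / n%:R ^+ 2) <= Dl.
  apply: le_trans X2 _; rewrite lerD2r; apply: lambda_max_ge.
  by apply: B_admissible; exists f0.
(* By [bin2_ge] the edit distance is at most [2 * q / n ^ 2], which is [4 / c] times the left side
   of [X3]. *)
apply: le_trans (edit_dist_le R G B f0) _; rewrite -/q.
apply: le_trans (_ : 4 / c * Dl <= _); last by rewrite ler_wpM2r// /C'; lra.
apply: le_trans (_ : 4 / c * (c / 2 * (q%:R / n%:R ^+ 2)) <= _); last by rewrite ler_pM2l.
have -> : 4 / c * (c / 2 * (q%:R / n%:R ^+ 2)) = q%:R * (2 / n%:R ^+ 2) :> R.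
  by field; rewrite !gt_eqF.
rewrite -mulrA ler_wpM2l ?ler0n// -invfM -[2 / _]invrK invf_div.
rewrite lef_pV2 ?posrE ?divr_gt0 ?mulr_gt0 ?exprn_gt0//.
by have := bin2_ge R n2; lra.
Qed.
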